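(* Let $G$ be a finitely generated group with arithmetic word problem. Suppose $\kappa$ is an infinite cardinal such that $2^\kappa=\kappa^+$. Let $D$ be a non-principal ultrafilter on $\kappa$ and let $G^*=\prod_{i\in\kappa}G/D$ and $\mathbb Z^*=\prod_{i\in\kappa}\mathbb Z/D$ be the corresponding ultrapowers. Then $G^*\cong\widetilde G$ as groups, where $\widetilde G$ denotes the nonstandard model $G(\mathbb Z^* )$.
   Context: An absolute interpretation $\Gamma$ of an $L$-structure $\mathbb A$ in a structure $\mathbb B$ is a family of parameter-free formulas of the language of $\mathbb B$: $U_\Gamma(\bar x)$, $E_\Gamma(\bar x,\bar x')$ and $Q_\Gamma$ for each symbol $Q\in L$ (in $n$-tuples of variables), such that $E_\Gamma$ defines an equivalence relation on the set $U_\Gamma(\mathbb B)\subseteq B^n$, the $Q_\Gamma$ define (the preimages of the graphs of) constants, operations and relations on the quotient, and the resulting $L$-structure $\Gamma(\mathbb B)$ is isomorphic to $\mathbb A$. For $\widetilde{\mathbb B}\equiv\mathbb B$ the same formulas define an $L$-structure $\Gamma(\widetilde{\mathbb B})$. A group $G$ with finite generating set $g_1,\dots,g_k$ has arithmetic word problem if the set of finite group words in $g_1^{\pm1},\dots,g_k^{\pm1}$ equal to $1$ in $G$ is, under a Gödel enumeration of words, definable by a first-order formula in $\langle\mathbb N;+,\cdot,0,1\rangle$. Such a $G$ is absolutely interpretable in the ring $\mathbb Z$ (by codes of group words modulo equality in $G$, multiplication being concatenation). For $\widetilde{\mathbb Z}\equiv\mathbb Z$, the nonstandard model $G(\widetilde{\mathbb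 Z})$ is the group $\Gamma(\widetilde{\mathbb Z})$, where $\Gamma$ is any absolute interpretation of $G$ in $\mathbb Z$; up to isomorphism it does not depend on $\Gamma$. *)

(* Defs.v *)
From HB Require Import structures.
From Stdlib Require Export RelationClasses.
From mathcomp Require Export all_boot all_order all_algebra.
From mathcomp Require Export all_classical.

Set Implicit Arguments.
Unset Strict Implicit.
Unset Printing Implicit Defensive.

Local Open Scope classical_set_scope.
Local Open Scope quotient_scope.

(* Constants are function symbols of arity 0. *)
Record signature := Signature {
  fsym : Type;
  farity : fsym -> nat;
  rsym : Type;
  rarity : rsym -> nat
}.

Record structure (L : signature) := Structure {
  carrier :> Type;
  fun_interp : forall f : fsym L, ('I_(farity f) -> carrier) -> carrier;
  rel_interp : forall r : rsym L, ('I_(rarity r) -> carrier) -> Prop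
}.
Arguments fun_interp {L} s f _.
Arguments rel_interp {L} s r _.

(* [term L V] and [formula L V] are the terms and formulas whose free variables
   belong to V.  The body of a quantifier has the additional variable [None].
   There is no constructor for parameters, and the omitted connectives are
   definable classically. *)
Inductive term (L : signature) (V : Type) :=
| Var of V
| App (f : fsym L) of ('I_(farity f) -> term L V).

Inductive formula (L : signature) (V : Type) :=
| Equal of term L V & term L V
| Rel (r : rsym L) of ('I_(rarity r) -> term L V)
| Not of formula L V
| And of formula L V & formula L V
| Exists of formula L (option V).

Fixpoint eval (L : signature) (M : structure L) (V : Type) (v : V -> M)
    (t : term L V) : M :=
  match t with
  | Var x => v x
  | @App _ _ f ts => fun_interp M f (fun j => eval v (ts j))
  end.

Fixpoint sat (L : signature) (M : structure L) (V : Type) (v : V -> M)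
    (phi : formula L V) {struct phi} : Prop :=
  match phi with
  | Equal s t => eval v s = eval v t
  | @Rel _ _ r ts => rel_interp M r (fun j => eval v (ts j))
  | Not phi1 => ~ sat v phi1
  | And phi1 phi2 => sat v phi1 /\ sat v phi2
  | Exists phi1 => exists x : M, sat (oapp v x) phi1
  end.

Definition isomorphic (L : signature) (M N : structure L) : Prop :=
  exists h : M -> N,
    [/\ bijective h,
        forall f (a : 'I_(farity f) -> M),
          h (fun_interp M f a) = fun_interp N f (h \o a)
      & forall r (a : 'I_(rarity r) -> M),
          rel_interp M r a <-> rel_interp N r (h \o a)].

Lemma asbool_equiv (T : Type) (R : T -> T -> Prop) :
  Equivalence R ->
  equiv_class_of (fun x y : {classic T} => `[< R x y >]).
Proof.
move=> [refl sym trans]; split.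
- by move=> x; apply/asboolP.
- by move=> x y; apply/asbool_equiv_eq; split; apply: sym.
- by move=> y x z /asboolP xy /asboolP yz; apply/asboolP; apply: trans yz.
Qed.

Definition quotient (T : Type) (R : T -> T -> Prop) (eqR : Equivalence R) :=
  {eq_quot EquivRelPack (asbool_equiv eqR)}.

Definition class_of (T : Type) (R : T -> T -> Prop) (eqR : Equivalence R)
  (x : T) : quotient eqR := \pi_(quotient eqR) (x : {classic T}).

Definition repr_of (T : Type) (R : T -> T -> Prop) (eqR : Equivalence R)
  (c : quotient eqR) : T := repr c.

Lemma eq_mod_filter (I M : Type) (D : set_system I) : Filter D ->
  Equivalence (fun f g : I -> M => D [set i | f i = g i]).
Proof.
move=> FD; split.
- by move=> f; apply: filterE.
- by move=> f g; apply: filterS => i /= ->.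
- by move=> f g h; apply: filterS2 => i /= -> ->.
Qed.

(* As D is a filter, the operations and relations do not depend on the
   representatives chosen by [repr_of]. *)
Definition ultrapower (L : signature) (I : Type) (D : set_system I)
    (UD : UltraFilter D) (M : structure L) : structure L :=
  let eqD := eq_mod_filter M (@ultra_proper I D UD) in
  @Structure L (quotient eqD)
    (fun f a => class_of eqD
       (fun i => fun_interp M f (fun j => repr_of (a j) i)))
    (fun r a => D [set i | rel_interp M r (fun j => repr_of (a j) i)]).

(* Variables of the formulas are indexed so that every argument is a block of
   [idim] variables: in [idom], the variable i is the i-th coordinate; in [ieq],
   [inl i] and [inr i] are the i-th coordinates of the first and of the second
   tuple; in [irel r] and [ifun f], (j, i) and (Some j, i) are the i-th
   coordinate of the j-th argument and, in [ifun f], (None, i) is the i-th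
   coordinate of the value. *)
Record interpretation (L K : signature) := Interpretation {
  idim : nat;
  idom : formula K 'I_idim;
  ieq : formula K ('I_idim + 'I_idim);
  ifun : forall f : fsym L, formula K (option 'I_(farity f) * 'I_idim);
  irel : forall r : rsym L, formula K ('I_(rarity r) * 'I_idim)
}.

Definition tuple_in (L K : signature) (Gamma : interpretation L K)
  (B : structure K) := {x : 'I_(idim Gamma) -> B | sat x (idom Gamma)}.

Definition tuple_eq (L K : signature) (Gamma : interpretation L K)
    (B : structure K) (x y : tuple_in Gamma B) : Prop :=
  sat (fun s => match s with inl i => sval x i | inr i => sval y i end)
      (ieq Gamma).

Definition tuple_fun (L K : signature) (Gamma : interpretation L K)
    (B : structure K) (f : fsym L)
    (x : 'I_(farity f) -> tuple_in Gamma B) (y : tuple_in Gamma B) : Prop :=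
  sat (fun p : option 'I_(farity f) * 'I_(idim Gamma) =>
         sval (oapp x y p.1) p.2)
      (ifun Gamma f).

Definition tuple_rel (L K : signature) (Gamma : interpretation L K)
    (B : structure K) (r : rsym L)
    (x : 'I_(rarity r) -> tuple_in Gamma B) : Prop :=
  sat (fun p : 'I_(rarity r) * 'I_(idim Gamma) => sval (x p.1) p.2)
      (irel Gamma r).

(* The formulas of Gamma define an equivalence relation in B and, modulo this
   relation, total operations and relations. *)
Record admissible (L K : signature) (Gamma : interpretation L K)
    (B : structure K) : Prop := Admissible {
  adm_equiv : Equivalence (@tuple_eq L K Gamma B);
  adm_fun_compat : forall f (x x' : 'I_(farity f) -> tuple_in Gamma B) y y',
    (forall j, tuple_eq (x j) (x' j)) -> tuple_eq y y' ->
    tuple_fun x y -> tuple_fun x' y';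
  adm_fun_total : forall f (x : 'I_(farity f) -> tuple_in Gamma B),
    exists y, tuple_fun x y;
  adm_fun_unique : forall f (x : 'I_(farity f) -> tuple_in Gamma B) y y',
    tuple_fun x y -> tuple_fun x y' -> tuple_eq y y';
  adm_rel_compat : forall r (x x' : 'I_(rarity r) -> tuple_in Gamma B),
    (forall j, tuple_eq (x j) (x' j)) -> tuple_rel x -> tuple_rel x'
}.

(* The structure Gamma(B).  By admissibility it does not depend on the choice of
   representatives, nor on the value selected by [cid]. *)
Definition interpreted (L K : signature) (Gamma : interpretation L K)
    (B : structure K) (adm : admissible Gamma B) : structure L :=
  let eqE := adm_equiv adm in
  @Structure L (quotient eqE)
    (fun f a => class_of eqE
       (sval (cid (adm_fun_total adm (fun j => repr_of (a j))))))
    (fun r a => tuple_rel (fun j => repr_of (a j))).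

Definition absolute_interpretation (L K : signature)
    (Gamma : interpretation L K) (A : structure L) (B : structure K) : Prop :=
  exists adm : admissible Gamma B, isomorphic (interpreted adm) A.

Variant group_symbol := GMul | GInv | GOne.

Definition group_signature : signature :=
  {| fsym := group_symbol;
     farity := fun f => match f with GMul => 2 | GInv => 1 | GOne => 0 end;
     rsym := Empty_set;
     rarity := fun r => match r with end |}.

Definition group_structure (G : groupType) : structure group_signature :=
  @Structure group_signature G
    (fun f => match f return ('I_(@farity group_signature f) -> G) -> G with
              | GMul => fun a => (a ord0 * a ord_max)%g
              | GInv => fun a => ((a ord0)^-1)%g
              | GOne => fun=> 1%g
              end)
    (fun r => match r with end).

Variant ring_symbol := RAdd | RMul | RZero | ROne.

Definition ring_signature : signature :=
  {| fsym := ring_symbol;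
     farity := fun f => match f with RAdd | RMul => 2 | RZero | ROne => 0 end;
     rsym := Empty_set;
     rarity := fun r => match r with end |}.

Definition ring_structure (R : pzSemiRingType) : structure ring_signature :=
  @Structure ring_signature R
    (fun f => match f return ('I_(@farity ring_signature f) -> R) -> R with
              | RAdd => fun a => (a ord0 + a ord_max)%R
              | RMul => fun a => (a ord0 * a ord_max)%R
              | RZero => fun=> 0%R
              | ROne => fun=> 1%R
              end)
    (fun r => match r with end).

(* The letter (i, b) stands for the i-th generator if b is false, and for its
   inverse if b is true. *)
Definition word_value (G : groupType) (k : nat) (g : 'I_k -> G)
    (w : seq ('I_k * bool)) : G :=
  (\prod_(l <- w) (if l.2 then (g l.1)^-1 else g l.1))%g.

Definition generates (G : groupType) (k : nat) (g : 'I_k -> G) : Prop :=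
  forall x : G, exists w, word_value g w = x.

Definition arithmetic_set (S : set nat) : Prop :=
  exists phi : formula ring_signature unit,
    forall m : nat, S m <-> sat (M := ring_structure nat) (fun=> m) phi.

(* [pickle] on words is an explicit, computable and injective numbering. *)
Definition arithmetic_word_problem (G : groupType) (k : nat) (g : 'I_k -> G)
  : Prop := arithmetic_set (pickle @` [set w | word_value g w = 1%g]).

Definition card_lt (X Y : Type) : Prop :=
  (([set: X] #<= [set: Y]) && ~~ ([set: Y] #<= [set: X]))%card.

(* The cardinality of S is the least cardinal above that of K. *)
Definition successor_cardinal (K S : Type) : Prop :=
  card_lt K S /\ forall X : Type, card_lt K X -> ([set: S] #<= [set: X])%card.

(* Main.v *)
Require Import Defs.

(** An interpretation of A in B amounts to a coding: a partial surjection from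
    tuples of B onto A through which the formulas of the interpretation express
    the domain, equality, operations and relations of A.  By Los's theorem a
    coding, taken coordinatewise modulo D, induces a coding of the ultrapower
    of A in the ultrapower of B.  So interpretations commute with ultrapowers. *)

Set Implicit Arguments.
Unset Strict Implicit.
Unset Printing Implicit Defensive.

Local Open Scope classical_set_scope.
Local Open Scope quotient_scope.

Section Quotient.
Variables (T : Type) (R : T -> T -> Prop) (eqR : Equivalence R).

Lemma class_ofP (x y : T) : class_of eqR x = class_of eqR y <-> R x y.
Proof.
split=> [/eqquotP/asboolP //|Rxy].
by apply/eqquotP/asboolP.
Qed.

Lemma repr_ofK (c : quotient eqR) : class_of eqR (repr_of c) = c.
Proof. exact: reprK. Qed.

Lemma repr_of_inj (c d : quotient eqR) : R (repr_of c) (repr_of d) <-> c = d.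
Proof. by rewrite -class_ofP !repr_ofK. Qed.

Lemma class_ofK (x : T) : R (repr_of (class_of eqR x)) x.
Proof. by apply/class_ofP; rewrite repr_ofK. Qed.

End Quotient.

Section Filter.
Variables (I : Type) (D : set_system I).

Lemma filter_iff (FD : Filter D) (P Q : set I) :
  D [set i | P i <-> Q i] -> D P <-> D Q.
Proof. by move=> DPQ; split; apply: filterS2 DPQ => i /= ->. Qed.

(** This supplies the existential case of Los's theorem and, later, the element coded by a tuple of
    an ultrapower. *)
Lemma filter_choice (FD : ProperFilter D) (T : Type) (P : I -> T -> Prop) :
  D [set i | exists x, P i x] <-> exists f : I -> T, D [set i | P i (f i)].
Proof.
split=> [DP|[f]]; last by apply: filterS => i Pi; exists (f i).
(* A member of a proper filter is nonempty, so [T] has an element [x0], the default at indices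
   without a witness. *)
have [i0 [x0 _]] := filter_ex DP.
have /choice[f Pf] : forall i, exists x, (exists y, P i y) -> P i x.
  move=> i; have [[x Px]|nP] := pselect (exists y, P i y); first by exists x.
  by exists x0 => /nP.
by exists f; apply: filterS DP => i; apply: Pf.
Qed.

(** Properness gives one direction, maximality of [D] the other. *)
Lemma ultra_not (UD : UltraFilter D) (P : set I) :
  D [set i | ~ P i] <-> ~ D P.
Proof.
split=> [DnP DP|nDP].
  by have [i []] := filter_ex (filterI DP DnP).
by case: (in_ultra_setVsetC P UD).
Qed.

End Filter.

Section Ultrapower.
Variables (I : Type) (D : set_system I) (UD : UltraFilter D).

Definition coord (L : signature) (M : structure L) (a : ultrapower UD M)
  (i : I) : M := repr_of a i.

Definition uclass (L : signature) (M : structure L) (f : I -> M) :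
  ultrapower UD M := class_of (eq_mod_filter M (@ultra_proper I D UD)) f.

Lemma coord_uclass (L : signature) (M : structure L) (f : I -> M) :
  D [set i | coord (uclass f) i = f i].
Proof. exact: (class_ofK (eq_mod_filter M _)). Qed.

Lemma coord_inj (L : signature) (M : structure L) (a b : ultrapower UD M) :
  D [set i | coord a i = coord b i] <-> a = b.
Proof. exact: (repr_of_inj (eqR := eq_mod_filter M _)). Qed.

Variables (L : signature) (M : structure L).

(** Equality holds only for almost all [i], since [coord (uclass f)] agrees with [f] only on a set
    of [D]. Arities are finite, so the sets obtained for the arguments can be intersected. *)
Lemma los_eval (V : Type) (v : V -> ultrapower UD M) (t : term L V) :
  D [set i | coord (eval v t) i = eval (fun x => coord (v x) i) t].
Proof.
elim: t => [x|f ts IH] /=; first exact: filterE.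
have /= := coord_uclass (fun i =>
  fun_interp M f (fun j => coord (eval v (ts j)) i)).
apply: filterS2 (filter_forall _ IH) => i /= ets ->.
by congr fun_interp; apply/funext.
Qed.

(** Los's theorem. The induction varies [V] and [v], since the body of a quantifier has one more
    variable. *)
Lemma los_sat (V : Type) (phi : formula L V) (v : V -> ultrapower UD M) :
  sat v phi <-> D [set i | sat (fun x => coord (v x) i) phi].
Proof.
elim: phi v => {V} [V s t|V r ts|V phi IH|V phi IH psi IH'|V phi IH] v /=.
- rewrite -coord_inj; apply: filter_iff.
  by apply: filterS2 (los_eval v s) (los_eval v t) => i /= -> ->.
- apply: filter_iff.
  apply: filterS (filter_forall _ (fun j => los_eval v (ts j))) => i /= ets.
  by rewrite (_ : (fun j => eval _ _) = fun j => coord (eval v (ts j)) i)//;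
    apply/funext.
- by rewrite IH ultra_not.
- rewrite IH IH'; split=> [[]|DP]; first exact: filterI.
  by split; apply: filterS DP => i [].
- have ext (x : ultrapower UD M) i : (fun o => coord (oapp v x o) i) =
      oapp (fun y => coord (v y) i) (coord x i) by apply/funext; case.
  rewrite filter_choice; split=> [[x /IH Dx]|[f Df]].
    by exists (coord x); apply: filterS Dx => i /=; rewrite ext.
  exists (uclass f); apply/IH.
  by apply: filterS2 (coord_uclass f) Df => i /= ef; rewrite ext ef.
Qed.

End Ultrapower.

(** Applied to the underlying tuples, this is convertible to the valuation in [tuple_eq]. *)
Definition pair_val (T U V : Type) (u : T -> V) (u' : U -> V) (s : T + U) : V :=
  match s with inl i => u i | inr i => u' i end.

(* [c u a] reads: the tuple [u] of [B] represents the element [a] of [A]. *)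
Record coding (L K : signature) (Gamma : interpretation L K)
    (A : structure L) (B : structure K)
    (c : ('I_(idim Gamma) -> B) -> A -> Prop) : Prop := Coding {
  coding_dom : forall u, sat u (idom Gamma) <-> exists a, c u a;
  coding_surj : forall a, exists u, c u a;
  coding_eq : forall u u' a a', c u a -> c u' a' ->
    sat (pair_val u u') (ieq Gamma) <-> a = a';
  coding_fun : forall f (u : 'I_(farity f) -> _) a y b,
    (forall j, c (u j) (a j)) -> c y b ->
    sat (fun p => oapp u y p.1 p.2) (ifun Gamma f) <-> fun_interp A f a = b;
  coding_rel : forall r (u : 'I_(rarity r) -> _) a,
    (forall j, c (u j) (a j)) ->
    sat (fun p => u p.1 p.2) (irel Gamma r) <-> rel_interp A r a
}.

Section Coding.
Variables (L K : signature) (Gamma : interpretation L K).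
Variables (A : structure L) (B : structure K).

Lemma tuple_funE (f : fsym L) (x : 'I_(farity f) -> tuple_in Gamma B) y :
  tuple_fun x y <->
  sat (fun p => oapp (fun j => sval (x j)) (sval y) p.1 p.2) (ifun Gamma f).
Proof.
rewrite /tuple_fun; set v := fun p => _; set w := fun p => _.
by rewrite (_ : v = w)//; apply/funext => -[[j|] i].
Qed.

Lemma interpretation_coding :
  absolute_interpretation Gamma A B ->
  exists c : ('I_(idim Gamma) -> B) -> A -> Prop, coding c.
Proof.
move=> [adm [h [[h' hK h'K] hfun hrel]]].
pose cl := class_of (adm_equiv adm).
have repr_cl x : tuple_eq (repr_of (cl x)) x := class_ofK (adm_equiv adm) x.
have [refl sym _] := adm_equiv adm.
have cl_repr x : tuple_eq x (repr_of (cl x)) by apply: sym.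
(* Trades a family of coded arguments for one family [x] in the domain of [Gamma], to which the
   clauses of admissibility apply. *)
have choice_tuples n (u : 'I_n -> 'I_(idim Gamma) -> B) (a : 'I_n -> A) :
    (forall j, exists2 x : tuple_in Gamma B, sval x = u j & h (cl x) = a j) ->
    exists2 x : 'I_n -> tuple_in Gamma B,
      u = (fun j => sval (x j)) & a = h \o (cl \o x).
  move=> ux; have /choice[x xP] j : exists x : tuple_in Gamma B,
    u j = sval x /\ a j = h (cl x) by have [x <- <-] := ux j; exists x.
  by exists x; apply/funext => j; have [] := xP j.
(* A tuple in the domain represents the image under [h] of its class. *)
exists (fun u a => exists2 x : tuple_in Gamma B, sval x = u & h (cl x) = a).
split.
- move=> u; split=> [p|[_ [[v p] <- _]]//].
  by exists (h (cl (exist _ u p))), (exist _ u p).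
- move=> a; exists (sval (repr_of (h' a : quotient (adm_equiv adm)))).
  by exists (repr_of (h' a : quotient _)); rewrite // /cl repr_ofK h'K.
- move=> _ _ _ _ [x <- <-] [x' <- <-]; split.
    by move=> exx'; congr h; apply/class_ofP.
  by move=> /(can_inj hK)/class_ofP.
- move=> f u a _ _ /choice_tuples[x -> ->] [y <- <-].
  rewrite -hfun -tuple_funE /=.
  (* The interpreted operation takes some value [z] at representatives of the arguments, so [y] is
     compared with [z] modulo [tuple_eq]. *)
  case: cid => z /= xz; split=> [xy|/(can_inj hK)/class_ofP zy].
    congr h; apply/class_ofP; apply: (adm_fun_unique adm xz).
    by apply: (adm_fun_compat adm) xy.
  by apply: (adm_fun_compat adm) xz.
- move=> r u a /choice_tuples[x -> ->].
  rewrite -hrel /=.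
  change (tuple_rel x <-> tuple_rel (fun j => repr_of (cl (x j)))).
  by split; apply: (adm_rel_compat adm).
Qed.

(** A coding is single-valued, hence amounts to a decoding map [val] on the domain. The formulas of
    [Gamma] are the pullbacks along [val] of equality, operations and relations of [A], which makes
    them admissible. *)
Lemma coding_interpretation (c : ('I_(idim Gamma) -> B) -> A -> Prop) :
  coding c -> exists adm : admissible Gamma B, isomorphic A (interpreted adm).
Proof.
move=> C.
have /choice[val cval] (x : tuple_in Gamma B) : exists a, c (sval x) a.
  by case: x => u /= /(coding_dom C).
have eqE (x y : tuple_in Gamma B) : tuple_eq x y <-> val x = val y.
  exact: (coding_eq C).
have funE f (x : 'I_(farity f) -> tuple_in Gamma B) y :
    tuple_fun x y <-> fun_interp A f (val \o x) = val y.
  by rewrite tuple_funE; apply: (coding_fun C) => [j|]; apply: cval.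
have relE r (x : 'I_(rarity r) -> tuple_in Gamma B) :
    tuple_rel x <-> rel_interp A r (val \o x).
  by apply: (coding_rel C (u := fun j => sval (x j))) => j; apply: cval.
have /choice[code codeK] a : exists x : tuple_in Gamma B, val x = a.
  have [u cua] := coding_surj C a.
  have p : sat u (idom Gamma) by apply/(coding_dom C); exists a.
  exists (exist _ u p).
  (* The tuple [u] represents both its decoded value and [a]; [ieq] holds of [u] with itself because
     [a = a], and this forces the two to be equal. *)
  by apply/(coding_eq C (cval (exist _ u p)) cua)/(coding_eq C cua cua).
have compE n (x x' : 'I_n -> tuple_in Gamma B) :
    (forall j, tuple_eq (x j) (x' j)) -> val \o x = val \o x'.
  by move=> exx'; apply/funext => j; apply/eqE.
have adm : admissible Gamma B.
  split.
  - split=> [x|x y /eqE xy|x y z /eqE xy /eqE yz]; apply/eqE => //.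
    by rewrite xy.
  - by move=> f x x' y y' /compE exx' /eqE eyy' /funE; rewrite exx' eyy' => /funE.
  - by move=> f x; exists (code (fun_interp A f (val \o x))); apply/funE.
  - by move=> f x y y' /funE xy /funE; rewrite xy => /eqE.
  - by move=> r x x' /compE exx' /relE; rewrite exx' => /relE.
exists adm; pose cl := class_of (adm_equiv adm).
have val_repr x : val (repr_of (cl x)) = val x.
  by apply/eqE; apply: class_ofK.
have val_code n (a : 'I_n -> A) : val \o (fun j => repr_of (cl (code (a j)))) = a.
  by apply/funext => j; rewrite /= val_repr.
exists (cl \o code); split.
- exists (fun q : quotient _ => val (repr_of q)) => [a|q] /=.
    by rewrite val_repr.
  by rewrite -[RHS]repr_ofK; apply/class_ofP/eqE.
- move=> f a /=; apply/class_ofP/eqE; rewrite codeK.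
  by case: cid => y /= /funE <-; rewrite val_code.
- by move=> r a /=; rewrite relE val_code.
Qed.

(** Los's theorem reduces each clause to that of [c] at almost every coordinate; dimension and
    arities are finite, so the sets of [D] involved can be intersected. *)
Lemma coding_ultrapower (I : Type) (D : set_system I) (UD : UltraFilter D)
    (c : ('I_(idim Gamma) -> B) -> A -> Prop) : coding c ->
  coding (fun (u : 'I_(idim Gamma) -> ultrapower UD B) (a : ultrapower UD A) =>
            D [set i | c (fun j => coord (u j) i) (coord a i)]).
Proof.
move=> C; split.
- move=> u; rewrite los_sat.
  rewrite (@filter_iff _ _ _ _ [set i | exists a, c (fun j => coord (u j) i) a]);
    last by apply: filterE => i; apply: (coding_dom C).
  (* Elements represented at almost all coordinates are collected in one function [f], whose class
     is the element represented by [u]. *)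
  rewrite filter_choice; split=> [[f Df]|[a Da]]; last by exists (coord a).
  by exists (uclass UD f); apply: filterS2 (coord_uclass UD f) Df => i /= ->.
- move=> a; have /choice[u cu] i := coding_surj C (coord a i).
  (* Component [j] of the code is the class of the [j]-th components of the codes [u i]. *)
  exists (fun j => uclass UD (u^~ j)).
  apply: filterS (filter_forall _ (fun j => coord_uclass UD (u^~ j))).
  move=> i /= eu; rewrite (_ : (fun j => _) = u i); first exact: cu.
  exact/funext.
- move=> u u' a a' Da Da'; rewrite los_sat -coord_inj; apply: filter_iff.
  apply: filterS2 Da Da' => i /= ca ca'.
  rewrite -(coding_eq C ca ca').
  by rewrite (_ : (fun s => _) = pair_val (fun j => coord (u j) i)
    (fun j => coord (u' j) i))//; apply/funext; case.
- move=> f u a y b Da Db; rewrite los_sat.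
  rewrite -coord_inj; apply: filter_iff.
  (* The operation of the ultrapower yields a class; [coord_uclass] identifies almost all its
     coordinates with values computed in [A]. *)
  apply: filterS3 (filter_forall _ Da) Db (coord_uclass UD (fun i =>
    fun_interp A f (fun j => coord (a j) i))) => i /= ca cb ->.
  rewrite -(coding_fun C ca cb).
  by rewrite (_ : (fun p => _) = fun p => oapp (fun j l => coord (u j l) i)
    (fun l => coord (y l) i) p.1 p.2)//; apply/funext => -[[]].
- move=> r u a Da; rewrite los_sat; apply: filter_iff.
  apply: filterS (filter_forall _ Da) => i /= ca.
  exact: (coding_rel C ca).
Qed.

End Coding.

Theorem theorem6p1 (G : groupType) (k : nat) (g : 'I_k -> G)
    (genG : generates g) (wpG : arithmetic_word_problem g)
    (kappa : Type) (inf_kappa : infinite_set [set: kappa])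
    (succ_kappa : successor_cardinal kappa (kappa -> bool))
    (D : set_system kappa) (UD : UltraFilter D)
    (nonprincipal : forall i : kappa, D <> principal_filter i)
    (Gamma : interpretation group_signature ring_signature)
    (int_Gamma : absolute_interpretation Gamma
                   (group_structure G) (ring_structure int)) :
  exists adm : admissible Gamma (ultrapower UD (ring_structure int)),
    isomorphic (ultrapower UD (group_structure G)) (interpreted adm).
Proof.
have [c C] := interpretation_coding int_Gamma.
exact: coding_interpretation (coding_ultrapower UD C).
Qed.
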